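(* For every $x \in (0,\pi)$ the following inequalities hold: $$\cos^{2}\frac{x}{2} \;\leq\; \left(\frac{\sin x}{x}\right)^{3/2} \;\leq\; \frac{\sin x}{x}.$$ *)

(* Defs.v *)
From Stdlib Require Import Reals.

(* Main.v *)
Require Import Defs.
From Stdlib Require Import Reals.
From Stdlib Require Import Lra.
Open Scope R_scope.

(** With [t = x / 2] one has [sin x / x = sin t * cos t / t], so squaring turns the
    left inequality into the Mitrinovic-Adamovic inequality
    [t ^ 3 * cos t <= sin t ^ 3]. That one follows from the Taylor bounds
    [sin t >= t - t^3/6] and [cos t <= 1 - t^2/2 + t^4/24], since
    [(1 - t^2/6)^3 - (1 - t^2/2 + t^4/24) = t^4 * (9 - t^2) / 216]. *)

Lemma sin_ge_cubic (t : R) : 0 <= t <= 4 -> t * (1 - t ^ 2 / 6) <= sin t.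
Proof.
  intros [H0 H4].
  (* Order [0] bounds [sin t] below by its first two Taylor terms; on the cosine side it bounds
     above by three. *)
  destruct (pre_sin_bound t 0 H0 H4) as [H _].
  unfold sin_approx, sin_term in H; simpl in H; lra.
Qed.

Lemma cos_le_quartic (t : R) :
  -2 <= t <= 2 -> cos t <= 1 - t ^ 2 / 2 + t ^ 4 / 24.
Proof.
  intros [H0 H2].
  destruct (pre_cos_bound t 0 H0 H2) as [_ H].
  unfold cos_approx, cos_term in H; simpl in H; lra.
Qed.

Lemma cube_mul_cos_le_sin_cube (t : R) :
  0 <= t <= 2 -> t ^ 3 * cos t <= sin t ^ 3.
Proof.
  intros Ht.
  assert (Hs := sin_ge_cubic t ltac:(lra)).
  assert (Hc := cos_le_quartic t ltac:(lra)).
  (* Keeps [9 - t ^ 2] nonnegative, and also [1 - t ^ 2 / 6], so that the sine bound may be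
     cubed. *)
  assert (Ht2 : t ^ 2 <= 4) by nra.
  apply Rle_trans with ((t * (1 - t ^ 2 / 6)) ^ 3).
  - rewrite Rpow_mult_distr.
    apply Rmult_le_compat_l; [apply pow_le; lra |].
    assert (0 <= t ^ 4 * (9 - t ^ 2))
      by (apply Rmult_le_pos; [apply pow_le |]; lra).
    lra.
  - apply pow_incr; split; [apply Rmult_le_pos; lra | exact Hs].
Qed.

Lemma Rpower_three_halves_sqr (u : R) : 0 < u -> Rpower u (3 / 2) ^ 2 = u ^ 3.
Proof.
  intros Hu.
  rewrite <- !Rpower_pow by (try apply exp_pos; exact Hu).
  rewrite Rpower_mult; f_equal; simpl; lra.
Qed.

Lemma pow2_le_reg (a b : R) : 0 <= b -> a ^ 2 <= b ^ 2 -> a <= b.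
Proof.
  intros Hb H; apply Rsqr_incr_0_var; [rewrite !Rsqr_pow2 |]; assumption.
Qed.

Theorem theorem4 :
  forall x : R, 0 < x < PI ->
    (cos (x / 2)) ^ 2 <= Rpower (sin x / x) (3 / 2)
    /\ Rpower (sin x / x) (3 / 2) <= sin x / x.
Proof.
  intros x [H0 Hpi].
  assert (Hu : 0 < sin x / x)
    by (apply Rdiv_lt_0_compat; [apply sin_gt_0 |]; assumption).
  assert (Hu1 : sin x / x <= 1)
    by (rewrite <- (Rdiv_diag x) by lra; apply Rmult_le_compat_r;
        [apply Rlt_le, Rinv_0_lt_compat | apply Rlt_le, sin_lt_x]; assumption).
  split; apply pow2_le_reg.
  - apply Rlt_le, exp_pos.
  - rewrite Rpower_three_halves_sqr by exact Hu.
    set (t := x / 2).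
    assert (Ht : 0 < t) by (unfold t; lra).
    (* [PI <= 4] gives [t < PI / 2 <= 2], the range of the cubic inequality. *)
    assert (Hpi4 := PI_4).
    assert (Hc : 0 <= cos t) by (apply cos_ge_0; unfold t; lra).
    assert (Hm := cube_mul_cos_le_sin_cube t ltac:(unfold t; lra)).
    replace (sin x / x) with (sin t * cos t / t)
      by (replace x with (2 * t) by (unfold t; lra); rewrite sin_2a; field; lra).
    replace ((sin t * cos t / t) ^ 3) with (sin t ^ 3 / t ^ 3 * cos t ^ 3)
      by (field; lra).
    (* Both sides now carry the nonnegative factor [cos t ^ 3]; cancelling it leaves
       [cos t <= sin t ^ 3 / t ^ 3]. *)
    replace ((cos t ^ 2) ^ 2) with (cos t * cos t ^ 3) by ring.
    apply Rmult_le_compat_r; [apply pow_le; exact Hc |].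
    apply Rmult_le_reg_l with (t ^ 3); [apply pow_lt; exact Ht |].
    replace (t ^ 3 * (sin t ^ 3 / t ^ 3)) with (sin t ^ 3) by (field; lra).
    exact Hm.
  - lra.
  - rewrite Rpower_three_halves_sqr by exact Hu.
    (* After squaring, the goal is [u ^ 3 <= u ^ 2] with [0 < u <= 1]. *)
    set (u := sin x / x) in *; nra.
Qed.
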